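(* Let $k$ be a positive integer and let $G = G[X,Y]$ be a bipartite graph with bipartition $(X,Y)$ such that $\mathrm{Mad}(G) \le 2k$. If $\deg(x) \ge k+1$ for every $x \in X$, then $\overrightarrow{\chi}(G) \le k+1$.
   Context: All graphs are finite and simple, with at least one vertex. $G[X,Y]$ denotes a bipartite graph whose vertex set is the disjoint union of $X$ and $Y$ and in which every edge joins a vertex of $X$ to a vertex of $Y$. The maximum average degree of a graph $G$ is $\mathrm{Mad}(G) = \max\{ 2|E(H)|/|V(H)| : H \text{ is a subgraph of } G \text{ with } V(H) \neq \emptyset\}$. An orientation $\sigma$ of $G$ is a digraph obtained from $G$ by replacing each edge by exactly one of the two possible arcs with the same end-vertices. For $v \in V(G)$, the indegree $d^-_{\sigma}(v)$ is the number of arcs of $\sigma$ incoming to $v$. A $k$-orientation is an orientation in which every vertex has indegree at most $k$. An orientation $\sigma$ is proper if $d^-_{\sigma}(u) \ne d^-_{\sigma}(v)$ for every edge $uv \in E(G)$. The proper orientation number $\overrightarrow{\chi}(G)$ is the minimum integer $k$ such that $G$ admits a proper $k$-orientation. *)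

(* Defs.v *)
From mathcomp Require Import all_boot all_order all_algebra.

Set Implicit Arguments.
Unset Strict Implicit.
Unset Printing Implicit Defensive.

Record sgraph := SGraph {
  vertex :> finType;
  adj : rel vertex;
  adj_sym : symmetric adj;
  adj_irrefl : irreflexive adj;
  vertex_nonempty : 0 < #|vertex| }.

Definition deg (G : sgraph) (v : G) : nat := #|[set u | adj v u]|.

Definition edges (G : sgraph) : {set {set G}} :=
  [set e : {set G} | [exists u, exists v, adj u v && (e == [set u; v])]].

Definition bipartition (G : sgraph) (X Y : {set G}) : Prop :=
  [/\ X :|: Y = [set: G],
      [disjoint X & Y]
    & forall u v : G, adj u v ->
        (u \in X /\ v \in Y) \/ (u \in Y /\ v \in X)].

(* A subgraph is a pair (W, F) of a vertex set and an edge set; it need not be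
   induced. *)
Definition subgraph (G : sgraph) (H : {set G} * {set {set G}}) : bool :=
  (H.2 \subset edges G) && [forall e in H.2, e \subset H.1].

(* The default value 0 of the iterated maximum is harmless: the range is
   nonempty, since G has a vertex, and all the averages are nonnegative. *)
Definition mad (G : sgraph) : rat :=
  (\big[Order.max/0]_(H : {set G} * {set {set G}}
                      | subgraph H && (H.1 != set0))
     ((2 * #|H.2|)%:R / #|H.1|%:R))%R.

(* An orientation is given by its set of arcs, (u, v) being the arc from u
   to v. *)
Definition orientation (G : sgraph) (A : {set G * G}) : bool :=
  [forall u, forall v,
     if adj u v then ((u, v) \in A) (+) ((v, u) \in A) else (u, v) \notin A].

Definition indeg (G : sgraph) (A : {set G * G}) (v : G) : nat :=
  #|[set u | (u, v) \in A]|.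

Definition k_orientation (G : sgraph) (k : nat) (A : {set G * G}) : bool :=
  orientation A && [forall v, indeg A v <= k].

Definition proper (G : sgraph) (A : {set G * G}) : bool :=
  [forall u, forall v, adj u v ==> (indeg A u != indeg A v)].

Definition has_proper_k_orientation (G : sgraph) (k : nat) : bool :=
  [exists A : {set G * G}, k_orientation k A && proper A].

(* Remove a vertex v of maximum degree, orient the rest properly, and direct
   all the edges at v towards v. *)
Lemma proper_orientation_on (G : sgraph) (S : {set G}) :
  exists A : {set G * G},
    [/\ forall u v, (u, v) \in A -> [/\ u \in S, v \in S & adj u v],
        forall u v, u \in S -> v \in S -> adj u v ->
          ((u, v) \in A) (+) ((v, u) \in A)
      & forall u v, u \in S -> v \in S -> adj u v -> indeg A u != indeg A v].
Proof.
have [n] := ubnP #|S|; elim: n S => // n IHn S leSn.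
have [->|[v0 v0S]] := set_0Vmem S.
  by exists set0; split=> [u v|u v|u v]; rewrite inE.
pose dS (u : G) := #|[set w in S | adj w u]|.
have [v vS vmax] : exists2 v, v \in S & forall u, u \in S -> dS u <= dS v.
  by have [v vS vmax] := arg_maxnP dS v0S; exists v.
have [|A [A1 A2 A3]] := IHn (S :\ v).
  by move: leSn; rewrite (cardsD1 v S) vS add1n ltnS.
pose B := A :|: [set a | [&& a.1 \in S, adj a.1 a.2 & a.2 == v]].
have inB u w : ((u, w) \in B) =
    ((u, w) \in A) || [&& u \in S, adj u w & w == v] by rewrite !inE.
have Av u : ((u, v) \in A) = false.
  by apply/negP => /A1[_]; rewrite !inE eqxx.
have vA u : ((v, u) \in A) = false.
  by apply/negP => /A1[]; rewrite !inE eqxx.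
have Bv : indeg B v = dS v.
  by apply: eq_card => u; rewrite !inE Av eqxx andbT.
have Bu u : u != v -> indeg B u = indeg A u.
  by move=> /negPf uv; apply: eq_card => w; rewrite !inE uv !andbF orbF.
have ltv u : u \in S -> adj u v -> indeg B u < indeg B v.
  move=> uS uv; have neq : u != v.
    by apply: contraTneq uv => ->; rewrite adj_irrefl.
  rewrite Bv Bu //; apply: leq_trans (vmax u uS).
  apply/proper_card/properP; split.
    apply/subsetP => w; rewrite !inE => /A1[].
    by rewrite !inE => /andP[_ ->] _ ->.
  by exists v; rewrite !inE ?vA // vS adj_sym.
exists B; split=> [u w|u w uS wS uw|u w uS wS uw].
- rewrite inB => /orP[/A1[]|/and3P[uS uw /eqP wv]]; last by split=> //; rewrite wv.
  by rewrite !inE => /andP[_ ->] /andP[_ ->].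
- rewrite !inB; have [uv|nuv] := eqVneq u v.
    move: uw; rewrite uv => uw; rewrite vA Av wS (adj_sym w) uw /= vS.
    have /negPf -> // : w != v.
    by apply: contraTneq uw => ->; rewrite adj_irrefl.
  have [wv|nwv] := eqVneq w v.
    by move: uw; rewrite wv Av vA uS => ->; rewrite !andbF.
  by rewrite !andbF !orbF; apply: A2; rewrite // !inE ?nuv ?nwv.
have [uv|nuv] := eqVneq u v.
  by rewrite gtn_eqF // uv; apply: ltv; rewrite // adj_sym -uv.
have [wv|nwv] := eqVneq w v.
  by rewrite ltn_eqF // wv; apply: ltv; rewrite // -wv.
by rewrite !Bu //; apply: A3; rewrite // !inE ?nuv ?nwv.
Qed.

Lemma ex_proper_k_orientation (G : sgraph) :
  exists k, has_proper_k_orientation G k.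
Proof.
have [A [A1 A2 A3]] := proper_orientation_on [set: G].
exists #|G|; apply/existsP; exists A; apply/andP; split; last first.
  apply/forallP => u; apply/forallP => v; apply/implyP => uv.
  by apply: A3; rewrite ?inE.
apply/andP; split; last by apply/forallP => v; apply: max_card.
apply/forallP => u; apply/forallP => v; case: ifP => uv.
  by apply: A2; rewrite ?inE.
by apply/negP => /A1[_ _]; rewrite uv.
Qed.

Definition proper_orientation_number (G : sgraph) : nat :=
  ex_minn (ex_proper_k_orientation G).

(* Main.v *)
Require Import Defs.
From mathcomp Require Import all_boot all_order all_algebra.
From mathcomp Require Import zify.

(** The orientation sought gives every vertex of X indegree exactly k + 1 and
    every vertex of Y indegree at most k; it is proper because every edge has
    one end in X and one in Y.

    The bounds are first achieved from above.  By Hakimi's theorem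
    [orientation_bounded], the indegrees can be kept below a prescribed
    function f as soon as every vertex set W spans at most
    \sum_(v in W) f v edges; for f = k this is what a maximum average degree
    of at most 2k says [edges_within_mad], and f = k + 1 on X only helps.

    The equality on X then comes for free [orientation_saturated].  Take such
    an orientation with as many arcs into X as possible.  A vertex x of X whose
    indegree is below k + 1 <= deg x has an outgoing arc, which leads to Y
    because X is independent; reversing it respects all the bounds and
    increases the number of arcs into X, a contradiction. *)

Set Implicit Arguments.
Unset Strict Implicit.
Unset Printing Implicit Defensive.

Section Orientations.

Variable G : sgraph.
Implicit Types (A : {set G * G}) (f : G -> nat) (W X : {set G}).

Definition edges_within W : {set {set G}} := [set e in edges G | e \subset W].

Definition reverse_arc A (u v : G) : {set G * G} := (v, u) |: A :\ (u, v).

Lemma orientation_arc_adj A u v : orientation A -> (u, v) \in A -> adj u v.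
Proof.
by move=> /forallP/(_ u)/forallP/(_ v); case: ifP => // _ /negPf->.
Qed.

Lemma orientation_xor A u v :
  orientation A -> adj u v -> ((u, v) \in A) = ((v, u) \notin A).
Proof.
move=> /forallP/(_ u)/forallP/(_ v) + uv; rewrite uv.
by case: (_ \in A); case: (_ \in A).
Qed.

Lemma orientation_asym A u v :
  orientation A -> (u, v) \in A -> (v, u) \notin A.
Proof.
by move=> oA uvA; rewrite -orientation_xor // (orientation_arc_adj oA uvA).
Qed.

Lemma orientation_arc_neq A u v : orientation A -> (u, v) \in A -> u != v.
Proof.
move=> oA uvA; apply: contraTneq (orientation_arc_adj oA uvA) => ->.
by rewrite adj_irrefl.
Qed.

Lemma orientation_reverse_arc A u v :
  orientation A -> (u, v) \in A -> orientation (reverse_arc A u v).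
Proof.
move=> oA uvA; have uv := orientation_arc_adj oA uvA.
have nuv := orientation_arc_neq oA uvA.
apply/forallP => a; apply/forallP => b.
rewrite !inE !xpair_eqE.
have /forallP/(_ a)/forallP/(_ b) := oA.
have [/andP[/eqP-> /eqP->]|n1] := boolP ((a == u) && (b == v)).
  by rewrite uv !eqxx (negPf nuv).
have [/andP[/eqP-> /eqP->]|n2] := boolP ((a == v) && (b == u)).
  by rewrite adj_sym uv !eqxx (eq_sym v) (negPf nuv).
by rewrite ![(b == _) && _]andbC (negPf n1) (negPf n2).
Qed.

Lemma indeg_reverse_arc A u v z :
  orientation A -> (u, v) \in A ->
  indeg (reverse_arc A u v) z + (z == v) = indeg A z + (z == u).
Proof.
move=> oA uvA; have nuv := orientation_arc_neq oA uvA.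
have vuA := orientation_asym oA uvA.
have [->|nzu] := eqVneq z u.
  rewrite (negPf nuv) addn0 /indeg (cardsD1 v) !inE eqxx /= addn1 add1n.
  congr _.+1; apply: eq_card => w; rewrite !inE !xpair_eqE eqxx andbT.
  by rewrite (negPf nuv) andbF; case: eqP => [->|]//=; rewrite (negPf vuA).
have [->|nzv] := eqVneq z v.
  rewrite addn0 addn1 /indeg [in RHS](cardsD1 u) inE uvA add1n.
  congr _.+1; apply: eq_card => w; rewrite !inE !xpair_eqE eqxx.
  by rewrite [v == u]eq_sym (negPf nuv) andbF andbT.
rewrite !addn0; apply: eq_card => w.
by rewrite !inE !xpair_eqE (negPf nzu) (negPf nzv) !andbF.
Qed.

(** Reversing a directed path shifts one unit of indegree from its end to its
    start and changes no other indegree.  The arcs are reversed one at a time;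
    simplicity of the path guarantees that reversing its first arc leaves the
    others in place. *)
Lemma reverse_path A x p :
    orientation A -> path (fun u v => (u, v) \in A) x p -> uniq (x :: p) ->
  exists2 A', orientation A'
    & forall z, indeg A' z + (z == last x p) = indeg A z + (z == x).
Proof.
elim: p x A => [|y p IHp] x A oA; first by exists A.
move=> /= /andP[xyA pA] /andP[xyp Uyp].
have pB : path (fun u v => (u, v) \in reverse_arc A x y) y p.
  apply: (sub_in_path (P := predC1 x)) pA; last first.
    by apply/allP => z /= zyp; apply: contraNneq xyp => <-.
  move=> u v + _ uvA; rewrite !inE !xpair_eqE uvA => /negPf->.
  by rewrite orbT.
have [A' oA' iA'] := IHp y _ (orientation_reverse_arc oA xyA) pB Uyp.
exists A' => // z; have := iA' z; have := indeg_reverse_arc z oA xyA; lia.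
Qed.

(** If no arc enters W from outside, the sum of the indegrees over W counts the
    arcs with both ends in W, and forgetting the directions is injective on the
    arcs of an orientation. *)
Lemma sum_indeg_le_edges_within A W :
    orientation A -> (forall u v, (u, v) \in A -> v \in W -> u \in W) ->
  \sum_(v in W) indeg A v <= #|edges_within W|.
Proof.
move=> oA clW; under eq_bigr do rewrite /indeg -sum1_card.
rewrite pair_big_dep /= sum1dep_card.
rewrite -(card_in_imset (f := fun a : G * G => [set a.2; a.1])); last first.
  move=> [v u] [v' u']; rewrite !inE /= => /andP[_ uvA].
  move=> /andP[_ uvA'] eq_e; have nuv' := orientation_arc_neq oA uvA'.
  have : u' \in [set u; v] by rewrite eq_e set21.
  have : v' \in [set u; v] by rewrite eq_e set22.
  case/set2P=> v'E /set2P[] u'E; rewrite v'E u'E ?eqxx // in uvA' nuv' *.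
  by rewrite (negPf (orientation_asym oA uvA)) in uvA'.
apply/subset_leq_card/subsetP => _ /imsetP[[v u] + ->].
rewrite !inE => /andP[/= vW uvA]; apply/andP; split.
  apply/existsP; exists u; apply/existsP; exists v.
  by rewrite (orientation_arc_adj oA uvA) eqxx.
by apply/subsetP => w /set2P[] -> //; apply: clW uvA vW.
Qed.

(** Hakimi's theorem.  Take an orientation with the least total excess over f,
    and suppose that v exceeds f v.  Let R be the set of the vertices from
    which v can be reached.  If some w in R were below f w, reversing a path
    from w to v would lower the excess.  Otherwise every vertex of R is at
    least at its bound, and v above; since all the arcs into R start in R,
    they come from edges spanned by R, which are then more than the sum of f
    over R. *)
Lemma orientation_bounded f :
    (forall W, #|edges_within W| <= \sum_(v in W) f v) ->
  exists2 A, orientation A & forall v, indeg A v <= f v.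
Proof.
move=> spanf.
have [A0 oA0] : exists A, orientation A.
  have [k /existsP[A /andP[/andP[oA _] _]]] := ex_proper_k_orientation G.
  by exists A.
pose excess A := \sum_v (indeg A v - f v).
have [A oA minA] := arg_minnP excess oA0.
exists A => // v; rewrite leqNgt; apply/negP => ltfv.
pose e := [rel u w | (u, w) \in A]; pose R := [set w | connect e w v].
have [/existsP[w /andP[]]|] := boolP [exists w in R, indeg A w < f w].
  rewrite inE => /connectP[p0 ep0 v_last0] ltwf.
  case/shortenP: ep0 v_last0 => p ep Up _ v_last.
  have [A' oA' iA'] := reverse_path oA ep Up.
  have nvw : v != w by apply: contraTneq ltfv => ->; rewrite -leqNgt ltnW.
  have := minA A' oA'; rewrite leqNgt => /negP[].
  rewrite /excess (bigD1 v) // [ltnRHS](bigD1 v) //= -addSn leq_add //.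
    by have := iA' v; rewrite -v_last eqxx (negPf nvw); lia.
  apply: leq_sum => z nzv; have := iA' z; rewrite -v_last (negPf nzv).
  by case: (eqVneq z w) => [->|_]; lia.
move=> /existsPn leR; have vR : v \in R by rewrite inE connect0.
have := sum_indeg_le_edges_within (W := R) oA.
have /[swap]/[apply] : forall u w, (u, w) \in A -> w \in R -> u \in R.
  move=> u w uwA; rewrite !inE => wv.
  by apply: connect_trans wv; apply: connect1.
move=> /leq_trans/(_ (spanf R)); rewrite leqNgt => /negP[].
rewrite (bigD1 v) // [ltnRHS](bigD1 v) //= -addSn leq_add //.
apply: leq_sum => w /andP[wR _].
by have := leR w; rewrite wR -leqNgt.
Qed.

(** On an independent set, upper bounds that do not exceed the degrees can be
    attained without breaking the bounds elsewhere: among the orientations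
    below f, take one with the most arcs into X; a vertex of X below its bound
    has an outgoing arc, which ends outside X and can thus be reversed. *)
Lemma orientation_saturated f X :
    (forall u v, u \in X -> v \in X -> ~~ adj u v) ->
    (forall x, x \in X -> f x <= deg x) ->
    (exists2 A, orientation A & forall v, indeg A v <= f v) ->
  exists A, [/\ orientation A, forall v, indeg A v <= f v
              & forall x, x \in X -> indeg A x = f x].
Proof.
move=> indepX leXdeg [A0 oA0 leA0].
pose P A := orientation A && [forall v, indeg A v <= f v].
have PA0 : P A0 by apply/andP; split=> //; apply/forallP.
have [A /andP[oA /forallP leA] maxA] :=
  arg_maxnP (fun A => \sum_(x in X) indeg A x) PA0.
exists A; split=> // x xX; apply/eqP; rewrite eqn_leq leA leqNgt.
apply/negP => ltxf.
have [y xyA] : exists y, (x, y) \in A.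
  apply/existsP; apply: contraLR (leq_trans ltxf (leXdeg x xX)).
  move=> /existsPn noout; rewrite -leqNgt; apply/subset_leq_card/subsetP => u.
  rewrite !inE => xu; have := noout u.
  by rewrite (orientation_xor oA xu) negbK.
have yX : y \notin X.
  apply/negP => yX; have := indepX x y xX yX.
  by rewrite (orientation_arc_adj oA xyA).
have iB z := indeg_reverse_arc z oA xyA.
have PB : P (reverse_arc A x y).
  rewrite /P orientation_reverse_arc //=; apply/forallP => z.
  by have := iB z; have := leA z; case: (eqVneq z x) => [->|_]; lia.
have := maxA _ PB; rewrite /= leqNgt => /negP[].
rewrite (bigD1 x) // [ltnRHS](bigD1 x) //= -addSn leq_add //.
  by have := iB x; rewrite eqxx (negPf (orientation_arc_neq oA xyA)); lia.
apply: leq_sum => z /andP[zX nzx].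
have nzy : z != y by apply: contraNneq yX => <-.
by have := iB z; rewrite (negPf nzx) (negPf nzy); lia.
Qed.

Lemma edges_within_mad k W :
  (mad G <= (2 * k)%:R)%R -> #|edges_within W| <= k * #|W|.
Proof.
move=> hmad; have [->|W0] := eqVneq W set0.
  rewrite cards0 muln0 leqn0 cards_eq0 -subset0; apply/subsetP => e.
  rewrite !inE subset0 => /andP[/existsP[u /existsP[v /andP[_ /eqP->]]]].
  by move=> /eqP/setP/(_ u); rewrite !inE eqxx.
have subW : subgraph (W, edges_within W) && (W != set0).
  rewrite W0 andbT /subgraph /=; apply/andP; split.
    by apply/subsetP => e; rewrite inE => /andP[].
  by apply/forallP => e; apply/implyP; rewrite inE => /andP[].
have leW : ((2 * #|edges_within W|)%:R / #|W|%:R <= mad G :> rat)%R.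
  exact: (Order.TotalTheory.le_bigmax_cond 0%R
    (P := fun H => subgraph H && (H.1 != set0))
    (fun H => (2 * #|H.2|)%:R / #|H.1|%:R)%R subW).
have {leW} := Order.POrderTheory.le_trans leW hmad.
have W_gt0 : 0 < #|W| by rewrite card_gt0.
rewrite Num.Theory.ler_pdivrMr ?Num.Theory.ltr0n //.
by rewrite -GRing.natrM Num.Theory.ler_nat -mulnA leq_pmul2l.
Qed.

End Orientations.

Theorem theorem2 (k : nat) (G : sgraph) (X Y : {set G})
  (hk : 0 < k)
  (hXY : bipartition X Y)
  (hmad : (mad G <= (2 * k)%:R)%R)
  (hdeg : forall x : G, x \in X -> k + 1 <= deg x) :
  proper_orientation_number G <= k + 1.
Proof.
have [_ /pred0P disjXY adjXY] := hXY.
have notXY v : v \in X -> v \in Y -> False.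
  by move=> vX vY; have := disjXY v; rewrite /= vX vY.
have [] := @orientation_saturated G (fun v => k + (v \in X)) X.
- move=> u v uX vX; apply/negP => /adjXY[[_ vY]|[uY _]].
    exact: notXY vX vY.
  exact: notXY uX uY.
- by move=> x xX; rewrite xX hdeg.
- apply: orientation_bounded => W; rewrite big_split /= sum_nat_const mulnC.
  exact: leq_trans (edges_within_mad _ hmad) (leq_addr _ _).
move=> A [oA leA eqA]; rewrite /proper_orientation_number.
have eqX v : v \in X -> indeg A v = k.+1.
  by move=> vX; rewrite eqA // vX addn1.
have leY v : v \in Y -> indeg A v <= k.
  move=> vY; apply: leq_trans (leA v) _.
  by case: (boolP (v \in X)) => [/notXY/(_ vY)//|_]; rewrite addn0.
case: ex_minnP => m _; apply; apply/existsP; exists A; apply/andP; split.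
  rewrite /k_orientation oA; apply/forallP => v.
  by apply: leq_trans (leA v) _; rewrite leq_add2l leq_b1.
apply/forallP => u; apply/forallP => v; apply/implyP.
move=> /adjXY[[uX vY]|[uY vX]].
  by rewrite (eqX u uX) gtn_eqF // ltnS leY.
by rewrite (eqX v vX) ltn_eqF // ltnS leY.
Qed.
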